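(* For every $n$-vertex graph $G$ that admits a join, $$\mathrm{mos}(G) \geq 2 \cdot \left\lceil \frac{n-2}{4} \right\rceil .$$ Moreover, this bound is tight even for cographs: there exist cographs admitting a join for which equality holds.
   Context: All graphs are finite, simple and undirected. A graph is called odd if every vertex has odd degree. $\mathrm{mos}(G)$ denotes the maximum number of vertices of an odd induced subgraph of $G$ (the empty graph counts as odd). A join in a graph $G$ is a partition of $V(G)$ into two non-empty sets $V_1$ and $V_2$ such that every vertex of $V_1$ is adjacent to every vertex of $V_2$; $G$ admits a join if such a partition exists. A cograph is a graph with no induced path on four vertices. *)

(* Defs.v *)
From HB Require Import structures.
From mathcomp Require Import all_boot all_order all_algebra.

Set Implicit Arguments.
Unset Strict Implicit.
Unset Printing Implicit Defensive.

Record sgraph := SGraph {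
  vertex :> finType;
  adj : rel vertex;
  adj_sym : symmetric adj;
  adj_irr : irreflexive adj }.

Definition degree (G : sgraph) (x : G) : nat := #|[set y | adj x y]|.

Definition odd_graph (G : sgraph) : bool := [forall x : G, odd (degree x)].

Section Induced.
Variables (G : sgraph) (S : {set G}).

Definition induced_adj : rel {x | x \in S} := fun x y => adj (val x) (val y).

Lemma induced_adj_sym : symmetric induced_adj.
Proof. by move=> x y; apply: adj_sym. Qed.

Lemma induced_adj_irr : irreflexive induced_adj.
Proof. by move=> x; apply: adj_irr. Qed.

Definition induced : sgraph := SGraph induced_adj_sym induced_adj_irr.

End Induced.

Definition mos (G : sgraph) : nat :=
  \max_(S : {set G} | odd_graph (induced S)) #|S|.

Definition is_join (G : sgraph) (V1 V2 : {set G}) : Prop :=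
  [/\ V1 != set0, V2 != set0, V1 :|: V2 = [set: G], [disjoint V1 & V2]
    & {in V1 & V2, forall x y, adj x y}].

Definition admits_join (G : sgraph) : Prop :=
  exists V1 V2 : {set G}, is_join V1 V2.

Definition path_adj (n : nat) : rel 'I_n :=
  fun i j => (i.+1 == j :> nat) || (j.+1 == i :> nat).

Lemma path_adj_sym n : symmetric (@path_adj n).
Proof. by move=> i j; rewrite /path_adj orbC. Qed.

Lemma path_adj_irr n : irreflexive (@path_adj n).
Proof. by move=> i; rewrite /path_adj orbb (gtn_eqF (ltnSn i)). Qed.

Definition path_graph (n : nat) : sgraph :=
  SGraph (@path_adj_sym n) (@path_adj_irr n).

Definition induced_copy (H G : sgraph) : Prop :=
  exists2 f : H -> G, injective f & {mono f : x y / adj x y}.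

Definition cograph (G : sgraph) : Prop := ~ induced_copy (path_graph 4) G.

Import GRing.Theory Num.Theory.
Local Open Scope ring_scope.

(* The ceiling is taken over the rationals, so no truncated subtraction or
   division intervenes. *)
Definition join_bound (n : nat) : int :=
  2 * Num.ceil ((n%:R - 2) / 4 : rat).

(* Main.v *)
(** Over F_2 the diagonal of a symmetric matrix lies in its row space. Applied to
    the Laplacian plus the identity, this yields Gallai's theorem: the vertices of
    a graph split into A and B, A inducing even and B inducing odd degrees. In a
    join, drop at most one vertex from each side to make both sides odd, and split
    them into A1, B1 and A2, B2. By the handshake lemma B1 and B2 have even size,
    hence A1 and A2 odd size, so A1 + A2 and B1 + B2 both induce odd graphs; the
    larger one has at least (n - 2) / 2 vertices, and its size is even.
    Equality holds for the cocktail party graphs K_{2,...,2} with an even number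
    of parts, whose odd induced subgraphs contain no two non-adjacent vertices. *)

Require Import Defs.
From mathcomp Require Import all_boot all_order all_algebra.
From mathcomp Require Import zify lra.

Set Implicit Arguments.
Unset Strict Implicit.
Unset Printing Implicit Defensive.

Import Order.TTheory GRing.Theory Num.Theory.

(** * Parity sums and linear algebra over F_2 *)

Lemma odd_card (T : finType) (A B : {set T}) :
  odd #|[set y in A | y \in B]| = \big[addb/false]_(y in A) (y \in B).
Proof.
rewrite -sum1_card (big_morph odd oddD (erefl _)).
rewrite (eq_bigl _ _ (in_set _)) big_mkcondr /=.
by apply: eq_bigr => y _; case: ifP.
Qed.

(** The terms [f x y] and [f y x] cancel in pairs off the diagonal. For an adjacency relation this
    is the handshake lemma. *)
Lemma sum_symmetric_addb (T : Type) (f : rel T) (r : seq T) : symmetric f ->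
  \big[addb/false]_(x <- r) \big[addb/false]_(y <- r) f x y =
  \big[addb/false]_(x <- r) f x x.
Proof.
move=> fC; elim: r => [|z r IHr]; first by rewrite !big_nil.
rewrite !big_cons.
under [X in _ (+) X]eq_bigr => x _ do rewrite big_cons.
rewrite big_split /= IHr.
under [X in _ (+) (X (+) _)]eq_bigr => x _ do rewrite fC.
by rewrite addbA addbK.
Qed.

(* Over F_2, if M y = 0 then 0 = y^T M y = \sum_i M_ii y_i, so the diagonal of
   a symmetric matrix M is orthogonal to its kernel. *)
Lemma diag_in_row_space (n : nat) (M : 'M[bool]_n) : M^T%R = M ->
  ((\row_i M i i)%R <= M)%MS.
Proof.
(* The columns of [cokermx M] span the kernel, so it suffices that the diagonal annihilates each of
   them. *)
move=> MT; rewrite submxE; apply/eqP/rowP=> j; rewrite !mxE /=.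
set y := cokermx M.
have My0 i : (\sum_k M i k * y k j)%R = 0%R.
  by have /matrixP/(_ i j) := mulmx_coker M; rewrite !mxE.
have gC : symmetric (fun i k => [&& M i k, y i j & y k j]).
  by move=> i k; rewrite -{1}MT mxE [y i j && _]andbC.
transitivity (\big[addb/false]_i [&& M i i, y i j & y i j]).
  by apply: eq_bigr => i _; rewrite mxE andbb.
rewrite -(sum_symmetric_addb _ gC) big1 // => i _.
have [yi|yi] := boolP (y i j); first by rewrite -[RHS](My0 i).
by rewrite big1 // => k _; rewrite andbF.
Qed.

(** [X] is the support of a combination of rows that yields the diagonal. *)
Lemma symmetric_system_addb (T : finType) (f : rel T) : symmetric f ->
  exists X : {set T}, forall v, \big[addb/false]_(u in X) f u v = f v v.
Proof.
move=> fC; pose M : 'M[bool]_#|T| :=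
  (\matrix_(i, j) f (enum_val i) (enum_val j))%R.
have /submxP [x Dx] : ((\row_i M i i)%R <= M)%MS.
  by apply: diag_in_row_space; apply/matrixP=> i j; rewrite !mxE fC.
exists [set u | x ord0 (enum_rank u)] => v.
have /rowP/(_ (enum_rank v)) := Dx; rewrite !mxE enum_rankK => ->.
rewrite big_mkcond /= (reindex _ (onW_bij _ (@enum_val_bij T))) /=.
apply: eq_bigr => i _; rewrite inE enum_valK mxE enum_rankK.
by case: (x ord0 i).
Qed.

(** * Degree parities in induced subgraphs *)

Section InducedDegree.
Variable G : sgraph.
Implicit Types (A B S : {set G}) (x y : G).

Definition degree_in S x : nat := #|[set y in S | adj x y]|.

Lemma odd_degree_in S x :
  odd (degree_in S x) = \big[addb/false]_(y in S) adj x y.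
Proof.
transitivity (odd #|[set y in S | y \in [set z | adj x z]]|).
  by congr (odd _); apply: eq_card => y; rewrite !inE.
by rewrite odd_card; apply: eq_bigr => y _; rewrite inE.
Qed.

Lemma degree_induced S (x : induced S) : degree x = degree_in S (val x).
Proof.
rewrite /degree /degree_in -(card_imset _ val_inj).
apply: eq_card => y; rewrite !inE; apply/imsetP/andP.
  by case=> z; rewrite inE => xz ->; split; [exact: (valP z) | ].
by case=> yS xy; exists (Sub y yS); rewrite ?inE.
Qed.

Lemma odd_induced S :
  reflect {in S, forall x, odd (degree_in S x)} (odd_graph (induced S)).
Proof.
apply: (iffP forallP) => [oS x xS|oS x].
  by have := oS (Sub x xS); rewrite degree_induced.
by rewrite degree_induced oS // (valP x).
Qed.

Lemma odd_degree_setU A B x : [disjoint A & B] ->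
  odd (degree_in (A :|: B) x) = odd (degree_in A x) (+) odd (degree_in B x).
Proof.
move=> dAB; rewrite !odd_degree_in -bigU //.
by apply: eq_bigl => y; rewrite !inE.
Qed.

Lemma degree_in_full S x : {in S, forall y, adj x y} -> degree_in S x = #|S|.
Proof.
move=> xS; apply: eq_card => y; rewrite inE.
by case: (boolP (y \in S)) => //= /xS.
Qed.

Lemma even_card_odd_induced S : odd_graph (induced S) -> ~~ odd #|S|.
Proof.
move=> /odd_induced oS.
have := sum_symmetric_addb (enum S) (@adj_sym G).
rewrite [RHS]big1 => [|x _]; last exact: adj_irr.
rewrite big_enum /= => sum0; apply/negbT; rewrite -[RHS]sum0.
rewrite (eq_bigr (fun x => x \in S)) => [|x xS]; last first.
  by rewrite big_enum -odd_degree_in oS.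
rewrite -odd_card; suff -> : [set y in S | y \in S] = S by [].
by apply/setP=> x; rewrite inE andbb.
Qed.

(* A is a solution over F_2 of (L + I) A = diag (L + I), where L is the
   Laplacian of the subgraph induced by S. *)
Lemma gallai_even_odd S : exists A B,
  [/\ A :|: B = S, [disjoint A & B],
      {in A, forall x, ~~ odd (degree_in A x)}
    & {in B, forall x, odd (degree_in B x)}].
Proof.
(* This is L + I modulo 2, extended by zero outside [S]: the diagonal entry at [x] is its degree
   plus one. *)
pose f x y := [&& x \in S, y \in S
  & adj x y (+) ((x == y) && ~~ odd (degree_in S x))].
have fC : symmetric f.
  move=> x y; rewrite /f andbCA adj_sym (eq_sym y).
  by case: eqP => [->|].
have [X XP] := symmetric_system_addb fC.
exists (S :&: X), (S :\: X).
have dAB : [disjoint S :&: X & S :\: X].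
  by rewrite disjoints_subset; apply/subsetP=> x; rewrite !inE => /andP[_ ->].
have SE : (S :&: X) :|: (S :\: X) = S by rewrite setID.
(* Row [x] of the system. For [x] in [X] the diagonal terms cancel, leaving an even degree into
   [S :&: X]; otherwise the degrees into [S :&: X] and [S] differ in parity, so the degree into
   [S :\: X] is odd. *)
have sumX x : x \in S -> odd (degree_in (S :&: X) x)
    (+) ((x \in X) && ~~ odd (degree_in S x)) = ~~ odd (degree_in S x).
  move=> xS; have := XP x; rewrite {2}/f xS adj_irr eqxx /= => {2}<-.
  under [RHS]eq_bigr => y _ do rewrite /f xS andTb.
  under [RHS]eq_bigr => y _ do rewrite andb_addr.
  rewrite big_split /=; congr (_ (+) _).
    rewrite odd_degree_in big_mkcond [RHS]big_mkcond /=.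
    apply: eq_bigr => y _; rewrite inE adj_sym.
    by case: (y \in S); case: (y \in X).
  have [xX|xX] := boolP (x \in X).
    rewrite (bigD1 x) //= xS eqxx big1 ?addbF // => y /andP[_ /negPf->].
    by rewrite andbF.
  rewrite big1 // => y yX; rewrite (_ : y == x = false) ?andbF //.
  by apply: contraNF xX => /eqP <-.
split=> // x; rewrite !inE => /andP[].
  by move=> xS xX; have := sumX x xS; rewrite xX; case: (odd _); case: (odd _).
move=> xX xS; have := sumX x xS; have := odd_degree_setU x dAB.
by rewrite SE (negPf xX) => ->; case: (odd _); case: (odd _).
Qed.

Lemma mos_ge S : odd_graph (induced S) -> #|S| <= mos G.
Proof. by move=> oS; apply: (leq_bigmax_cond S). Qed.

Lemma mos_witness : exists2 S : {set G}, odd_graph (induced S) & #|S| = mos G.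
Proof.
have o0 : odd_graph (induced (set0 : {set G})).
  by apply/odd_induced => x; rewrite inE.
have [|S oS SE] := @eq_bigmax_cond _ [pred S : {set G} | odd_graph (induced S)]
  (fun S : {set G} => #|S|); first by apply/card_gt0P; exists set0.
by exists S; rewrite // -SE.
Qed.

(** * Odd induced subgraphs of joins *)

(** A vertex sees the whole opposite side, which adds that side's size to its degree. This serves
    both even graphs of odd order and odd graphs of even order. *)
Lemma odd_induced_join A B :
    [disjoint A & B] -> {in A & B, forall x y, adj x y} ->
    {in A, forall x, odd (degree_in A x) = ~~ odd #|B|} ->
    {in B, forall x, odd (degree_in B x) = ~~ odd #|A|} ->
  odd_graph (induced (A :|: B)).
Proof.
move=> dAB jAB oA oB; apply/odd_induced => x.
rewrite in_setU odd_degree_setU // => /orP[xA|xB].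
  by rewrite (@degree_in_full B) ?oA ?addNb ?addbb // => y /(jAB x y xA).
rewrite (@degree_in_full A) ?oB ?addbN ?addbb // => y yA.
by rewrite adj_sym jAB.
Qed.

Lemma mos_join_odd_odd S1 S2 : odd #|S1| -> odd #|S2| ->
    [disjoint S1 & S2] -> {in S1 & S2, forall x y, adj x y} ->
  #|S1| + #|S2| <= (mos G).*2.
Proof.
have [A1 [B1 [<- dAB1 eA1 oB1]]] := gallai_even_odd S1.
have [A2 [B2 [<- dAB2 eA2 oB2]]] := gallai_even_odd S2.
have cardU A B : [disjoint A & B] -> #|A :|: B| = #|A| + #|B|.
  by move=> dAB; apply/eqP; rewrite (leq_card_setU A B).
have eB1 := even_card_odd_induced (introT (odd_induced B1) oB1).
have eB2 := even_card_odd_induced (introT (odd_induced B2) oB2).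
rewrite !cardU // !oddD (negPf eB1) (negPf eB2) !addbF => oA1 oA2 dS jS.
have [sA1 sB1] : A1 \subset A1 :|: B1 /\ B1 \subset A1 :|: B1.
  by rewrite subsetUl subsetUr.
have [sA2 sB2] : A2 \subset A2 :|: B2 /\ B2 \subset A2 :|: B2.
  by rewrite subsetUl subsetUr.
have dA : [disjoint A1 & A2] by apply: disjointW dS.
have dB : [disjoint B1 & B2] by apply: disjointW dS.
have oA : odd_graph (induced (A1 :|: A2)).
  apply: odd_induced_join => // [x y xA yA|x xA|x xA].
  - by apply: jS; [apply: (subsetP sA1) | apply: (subsetP sA2)].
  - by rewrite oA2 (negPf (eA1 x xA)).
  - by rewrite oA1 (negPf (eA2 x xA)).
have oB : odd_graph (induced (B1 :|: B2)).
  apply: odd_induced_join => // [x y xB yB|x xB|x xB].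
  - by apply: jS; [apply: (subsetP sB1) | apply: (subsetP sB2)].
  - by rewrite eB2 oB1.
  - by rewrite eB1 oB2.
by have := mos_ge oA; have := mos_ge oB; rewrite !cardU //; lia.
Qed.

Lemma odd_subset S : S != set0 ->
  exists S', [/\ S' \subset S, odd #|S'| & #|S| <= #|S'|.+1].
Proof.
case/set0Pn=> x xS; case oS: (odd #|S|); first by exists S.
exists (S :\ x); have := cardsD1 x S; rewrite xS subD1set => SE.
by split=> //; lia.
Qed.

(** The summand 2 pays for the vertex that each side may lose to become odd. *)
Lemma card_join_le_mos : admits_join G -> #|G| <= (mos G).*2 + 2.
Proof.
case=> V1 [V2 [/odd_subset[S1 [sS1 oS1 lS1]] /odd_subset[S2 [sS2 oS2 lS2]]]].
move=> VE dV jV; have dS : [disjoint S1 & S2] by apply: disjointW dV.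
have jS : {in S1 & S2, forall x y, adj x y}.
  by move=> x y /(subsetP sS1) xV /(subsetP sS2) yV; apply: jV.
have := mos_join_odd_odd oS1 oS2 dS jS.
have := leq_card_setU V1 V2; rewrite VE cardsT => -[cV _]; lia.
Qed.

Lemma even_mos : ~~ odd (mos G).
Proof. by have [S oS <-] := mos_witness; apply: even_card_odd_induced. Qed.

End InducedDegree.

(** * Arithmetic of the ceiling *)

(** Evenness of [mos] permits writing it as [k.*2], so that the rounding up costs nothing. *)
Lemma join_bound_le (n k : nat) :
  (join_bound n <= k.*2%:Z)%R = (n <= 4 * k + 2).
Proof.
have -> : (join_bound n <= k.*2%:Z)%R =
    (Num.ceil ((n%:R - 2) / 4 : rat) <= k%:Z)%R.
  by rewrite /join_bound; lia.
rewrite ceil_le_int ler_pdivrMr // lerBlDr -(ler_nat rat).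
by rewrite natrD natrM mulrC.
Qed.

(** The ceiling is that of k - 1/2. *)
Lemma join_bound_mul4 (k : nat) : join_bound (4 * k) = k.*2%:Z%R.
Proof.
rewrite /join_bound (_ : Num.ceil _ = k%:Z%R); first lia.
by apply: ceil_def; rewrite intrD natrM -[k%:~R%R]/(k%:R%R); lra.
Qed.

(** * Tightness: cocktail party graphs *)

Section CocktailParty.
Variable m : nat.

(** The pairs [(i, true)] and [(i, false)] are the two vertices of part [i] of K_{2,...,2}. *)
Definition cocktail_adj : rel ('I_m * bool) := fun x y => x.1 != y.1.

Lemma cocktail_adj_sym : symmetric cocktail_adj.
Proof. by move=> x y; rewrite /cocktail_adj eq_sym. Qed.

Lemma cocktail_adj_irr : irreflexive cocktail_adj.
Proof. by move=> x; rewrite /cocktail_adj eqxx. Qed.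

Definition cocktail_party : sgraph := SGraph cocktail_adj_sym cocktail_adj_irr.

Lemma card_cocktail_party : #|cocktail_party| = m.*2.
Proof. by rewrite card_prod card_ord card_bool muln2. Qed.

(* Non-adjacency is an equivalence relation, and it is not one in P_4. *)
Lemma cograph_cocktail_party : cograph cocktail_party.
Proof.
case=> f _ fE; have ok (i j : 'I_4) : ~~ path_adj i j -> (f i).1 = (f j).1.
  move=> nij; have := fE i j; rewrite /= (negPf nij) => /negbFE.
  exact: eqP.
(* Vertex 0 of the path is adjacent to neither 2 nor 3, so 2 and 3 land in one part although they
   are adjacent. *)
have := fE (inord 2) (inord 3).
rewrite /= /cocktail_adj -(ok (inord 0) (inord 2)) -?(ok (inord 0) (inord 3)).
- by rewrite eqxx /path_adj !inordK.
- by rewrite /path_adj !inordK.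
- by rewrite /path_adj !inordK.
Qed.

Lemma admits_join_cocktail_party : 1 < m -> admits_join cocktail_party.
Proof.
move=> m1; pose i0 := Ordinal (ltnW m1); pose i1 := Ordinal m1.
exists [set x : cocktail_party | x.1 == i0], (~: [set x | x.1 == i0]); split.
- by apply/set0Pn; exists (i0, true); rewrite inE.
- by apply/set0Pn; exists (i1, true); rewrite !inE.
- by rewrite setUCr.
- by rewrite disjoints_subset setCK.
- by move=> x y; rewrite !inE => /eqP xi yi; rewrite /= /cocktail_adj xi eq_sym.
Qed.

(** A vertex misses only itself and its antipode; the boolean counts the antipode. *)
Lemma degree_in_cocktail_party (S : {set cocktail_party}) x : x \in S ->
  (degree_in S x).+1 + ((x.1, ~~ x.2) \in S) = #|S|.
Proof.
move=> xS; rewrite (cardsD1 x) xS (cardsD1 (x.1, ~~ x.2)) !inE.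
have -> : (x.1, ~~ x.2) != x.
  by case: (x) => i b; rewrite xpair_eqE eqxx; case: b.
rewrite addSn add1n addnC; congr (_ + _).+1.
apply: eq_card => -[i b]; rewrite !inE /= /cocktail_adj /=; case: (x) => j c /=.
rewrite !xpair_eqE (eq_sym j) andbA -negb_or -andb_orr andbC.
by case: b c => [] []; rewrite ?andbT ?andbF ?orbF.
Qed.

(* The degree and |S| - 1 are both odd, so S contains no antipodal pair. *)
Lemma mos_cocktail_party : mos cocktail_party <= m.
Proof.
have [S oS <-] := mos_witness cocktail_party.
have nS x : x \in S -> (x.1, ~~ x.2) \notin S.
  move=> xS; have := degree_in_cocktail_party xS.
  have := even_card_odd_induced oS; have := odd_induced _ oS x xS.
  by case: (_ \in S) => //; lia.
(* Without antipodal pairs, [S] meets each of the [m] parts at most once. *)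
have fst_inj : {in S &, injective fst}.
  move=> [i b] [j c] xS yS /= ij; congr (_, _); first exact: ij.
  by have := nS _ xS; rewrite /= ij; case: b c yS {xS} => [] [] //= ->.
by rewrite -(card_in_imset fst_inj) -[leqRHS]card_ord max_card.
Qed.

End CocktailParty.

Theorem theorem8 :
  (forall G : sgraph, admits_join G ->
     (join_bound #|G| <= (mos G)%:Z)%R)
  /\
  (forall N : nat, exists G : sgraph,
     [/\ (N <= #|G|)%N, cograph G, admits_join G
       & (mos G)%:Z%R = join_bound #|G|]).
Proof.
have lower G : admits_join G -> (join_bound #|G| <= (mos G)%:Z)%R.
  move=> /card_join_le_mos; rewrite -(even_halfK (even_mos G)) join_bound_le.
  lia.
(* An even number of parts makes the order 4(N + 1), where the bound equals the number of parts, 2(N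
   + 1). *)
split=> // N; exists (cocktail_party N.+1.*2).
have jG : admits_join (cocktail_party N.+1.*2).
  by apply: admits_join_cocktail_party; lia.
have cG := card_cocktail_party N.+1.*2.
split=> //; first by rewrite cG; lia.
  exact: cograph_cocktail_party.
apply/eqP; rewrite eq_le lower // andbT cG.
have -> : N.+1.*2.*2 = 4 * N.+1 by lia.
by rewrite join_bound_mul4 lez_nat mos_cocktail_party.
Qed.
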